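(* Let $\mathcal A_+,\mathcal A_-\subseteq\mathbb Z^n$ be disjoint finite sets, $\mathcal A=\mathcal A_+\cup\mathcal A_-$, and assume $\mathcal A_-\neq\varnothing$ and $\operatorname{vertices}(\operatorname{conv}(\mathcal A))\subseteq\mathcal A_+$. Let $\Gamma$ be the smallest face of $\operatorname{conv}(\mathcal A)$ containing $\mathcal A_-$, and let $J$ be the set of faces $\Gamma'$ of $\Gamma$ with $\Gamma'\cap\mathcal A_-\neq\varnothing$. Let $f\in\mathcal S(\mathcal A_+,\mathcal A_-)$ have nonsigned coefficients $c\in\mathbb R^{\mathcal A}_{>0}$, and let $h:\mathcal A\to\mathbb Z$ be a height function lifting $\mathcal A_-$. Define $$S:=\bigcup_{\Gamma'\in J}\{t\in\mathbb R_{>0}:\ F^{\Gamma'}(\pi_{\Gamma'}(c\star t^h),x)=0\text{ for some }x\in\mathbb R^n_{>0}\}.$$ Then (i) $S$ has a minimum $t_*$; and (ii) $f$ is copositive if and only if $t_*\ge 1$.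
   Context: For disjoint finite $\mathcal A_+,\mathcal A_-\subseteq\mathbb R^n$, a signomial with signed support $(\mathcal A_+,\mathcal A_-)$ is a function $f:\mathbb R^n_{>0}\to\mathbb R$, $f(x)=\sum_{a\in\mathcal A_+}c_ax^a-\sum_{b\in\mathcal A_-}c_bx^b$ with all $c_a,c_b>0$ (the nonsigned coefficients), where $x^a=\prod_i x_i^{a_i}$. $\mathcal A=\mathcal A_+\cup\mathcal A_-$ is the support; $\mathcal S(\mathcal A_+,\mathcal A_-)$ is the set of such signomials, identified with $\mathbb R^{\mathcal A}_{>0}$ via the nonsigned coefficients; $f_c$ denotes the signomial with nonsigned coefficients $c$. $f$ is copositive if $f(x)\ge0$ for all $x\in\mathbb R^n_{>0}$. The critical system of $(\mathcal A_+,\mathcal A_-)$ is $F(c,x)=(f_c(x),x_1\partial_{x_1}f_c(x),\dots,x_n\partial_{x_n}f_c(x))$ for $c\in\mathbb R^{\mathcal A}_{>0}$, $x\in\mathbb R^n_{>0}$. For a nonempty face $\Gamma'$ of $\operatorname{conv}(\mathcal A)$, $\mathcal A^{\Gamma'}_\pm=\mathcal A_\pm\cap\Gamma'$, $\mathcal A^{\Gamma'}=\mathcal A\cap\Gamma'$, $\pi_{\Gamma'}:\mathbb R^{\mathcal A}\to\mathbb R^{\mathcal A^{\Gamma'}}$ is the coordinate projection, and $F^{\Gamma'}$ is the critical system of $(\mathcal A^{\Gamma'}_+,\mathcal A^{\Gamma'}_-)$ (i.e. of the truncation $f^{\Gamma'}$, obtained by keeping only the terms of $f$ with exponent in $\Gamma'$).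 A height function $h:\mathcal A\to\mathbb Z$ lifts $\mathcal A_-$ if $h(a)>0$ for $a\in\mathcal A_-$ and $h(a)=0$ for $a\in\mathcal A_+$; $c\star t^h$ denotes the vector $(c_at^{h(a)})_{a\in\mathcal A}$. *)

(* Defs.v *)
From HB Require Import structures.
From mathcomp Require Import all_boot all_order all_algebra.
From mathcomp Require Import boolp reals.
Set Implicit Arguments. Unset Strict Implicit. Unset Printing Implicit Defensive.
Import Order.TTheory GRing.Theory Num.Theory.
Local Open Scope ring_scope.

Section Defs.
Variables (R : realType) (n : nat).

Definition vecR (a : 'rV[int]_n) : 'rV[R]_n := map_mx (fun z : int => z%:~R) a.

Definition dotR (w x : 'rV[R]_n) : R := \sum_(i < n) w 0 i * x 0 i.

Definition conv (A : seq 'rV[int]_n) : 'rV[R]_n -> Prop :=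
  fun x => exists l : 'rV[int]_n -> R,
    (forall a, 0 <= l a) /\ \sum_(a <- A) l a = 1 /\
    x = \sum_(a <- A) l a *: vecR a.

(* F is a (nonempty) face of the polytope P: the set of maximizers over P
   of some linear functional w (w = 0 gives P itself). *)
Definition face_of (P F : 'rV[R]_n -> Prop) : Prop :=
  exists w : 'rV[R]_n, forall x,
    F x <-> (P x /\ forall y, P y -> dotR w y <= dotR w x).

Definition vertex (P : 'rV[R]_n -> Prop) (v : 'rV[R]_n) : Prop :=
  face_of P (fun x => x = v).

Definition posvec (x : 'rV[R]_n) : Prop := forall i, 0 < x 0 i.

Definition mono (x : 'rV[R]_n) (a : 'rV[int]_n) : R :=
  \prod_(i < n) (x 0 i) ^ (a 0 i).

Definition signomial (Ap Am : seq 'rV[int]_n) (c : 'rV[int]_n -> R)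
  (x : 'rV[R]_n) : R :=
  \sum_(a <- Ap) c a * mono x a - \sum_(b <- Am) c b * mono x b.

(* x_i * d/dx_i of the signomial *)
Definition xdsignomial (Ap Am : seq 'rV[int]_n) (c : 'rV[int]_n -> R)
  (x : 'rV[R]_n) (i : 'I_n) : R :=
  \sum_(a <- Ap) c a * (a 0 i)%:~R * mono x a
  - \sum_(b <- Am) c b * (b 0 i)%:~R * mono x b.

Definition crit_zero (Ap Am : seq 'rV[int]_n) (c : 'rV[int]_n -> R)
  (x : 'rV[R]_n) : Prop :=
  signomial Ap Am c x = 0 /\ forall i, xdsignomial Ap Am c x i = 0.

Definition copositive (Ap Am : seq 'rV[int]_n) (c : 'rV[int]_n -> R) : Prop :=
  forall x, posvec x -> 0 <= signomial Ap Am c x.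

Definition trunc (G : 'rV[R]_n -> Prop) (A : seq 'rV[int]_n) :=
  [seq a <- A | `[< G (vecR a) >] ].

Definition lifts (Ap Am : seq 'rV[int]_n) (h : 'rV[int]_n -> int) : Prop :=
  (forall a, a \in Am -> 0 < h a) /\ (forall a, a \in Ap -> h a = 0).

End Defs.
Arguments vecR {R n} a.
Arguments conv {R n} A.
Arguments trunc {R n} G A.

(* Main.v *)
(** Along the path t |-> f_t with coefficients c * t^h, the values f_t(x) decrease in t,
    so the t with f_t^Gamma copositive form an interval. It is nonempty because every
    monomial is bounded by a constant times a monomial at a vertex, hence in A_+, and
    bounded because A_- is nonempty; t_* is its supremum, which belongs to it by continuity.
    Truncation to a face is a limit along a one-parameter subgroup, so it preserves
    copositivity: for t < t_*, every f_t^{Gamma'} with Gamma' in J exceeds the nonnegative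
    f_{t_*}^{Gamma'} and has no zero. Conversely, pick t_k decreasing to t_* and x_k with
    f_{t_k}^Gamma(x_k) < 0; by compactness the normalized monomials at x_k accumulate at the
    monomials of some point x on some face Gamma', so f_{t_*}^{Gamma'}(x) <= 0. As
    f_{t_*}^{Gamma'} is copositive this is a zero and a minimum, hence a critical point, and
    Gamma' meets A_- since otherwise f_{t_*}^{Gamma'}(x) > 0.
    Points of the positive orthant are written x = exp(u). *)

Require Import Defs.
From HB Require Import structures.
From mathcomp Require Import all_boot all_order all_algebra.
From mathcomp Require Import all_classical all_reals topology normedtype sequences.
From mathcomp Require Import derive realfun exp ring lra.
Import Order.TTheory GRing.Theory Num.Theory.
Import numFieldNormedType.Exports.
Local Open Scope ring_scope.

(** * Convergence along filters and ultrafilters *)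

Section UltraLimits.
Local Open Scope classical_set_scope.

Lemma filter_all_in (T : Type) (F : set_system T) (I : eqType) (s : seq I)
    (P : I -> T -> Prop) : Filter F ->
  (forall i, i \in s -> \forall x \near F, P i x) ->
  \forall x \near F, forall i, i \in s -> P i x.
Proof.
move=> FF; elim: s => [|j s IH] H; first by near=> x.
have H1 := IH (fun i si => H i (mem_behead (s := j :: s) si)).
have H2 := H j (mem_head j s).
near=> x => i; rewrite inE => /orP[/eqP ->|si].
  by near: x.
by move: i si; near: x.
Unshelve. all: by end_near. Qed.

Lemma cvg_sum_in {R : realType} (T : Type) (F : set_system T) (I : eqType)
    (s : seq I) (f : I -> T -> R) (l : I -> R) : Filter F ->
  (forall i, i \in s -> f i x @[x --> F] --> l i) ->
  (\sum_(i <- s) f i x) @[x --> F] --> \sum_(i <- s) l i.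
Proof.
move=> FF; elim: s => [|j s IH] H.
  by under eq_fun do rewrite big_nil; rewrite big_nil; exact: cvg_cst.
under eq_fun do rewrite big_cons; rewrite big_cons.
apply: cvgD; first by apply: H; rewrite mem_head.
by apply: IH => i si; apply: H; rewrite inE si orbT.
Qed.

(** Induction on the list: an ultrafilter contains either the level set of the head or its
    complement, and the latter confines [f] to the tail. *)
Lemma ultra_pigeonhole (T : Type) (U : set_system T) (I : eqType) (s : seq I)
    (f : T -> I) : UltraFilter U ->
  (forall x, f x \in s) -> exists2 i, i \in s & U [set x | f x = i].
Proof.
move=> UU fs.
suff H (r : seq I) : U [set x | f x \in r] ->
    exists2 i, i \in r & U [set x | f x = i].
  by apply: H; apply: filterE.
elim: r => [|j r IH].
  move=> H; exfalso; apply: (@filter_not_empty _ U); apply: filterS H => x.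
  by [].
move=> H; have [Hj|Hj] := in_ultra_setVsetC [set x | f x = j] UU.
  by exists j; rewrite ?mem_head.
case: IH => [|i ir Hi]; last by exists i => //; rewrite inE ir orbT.
near=> x; have : f x \in j :: r by near: x.
rewrite inE => /orP[/eqP fxj|//]; exfalso.
by move: fxj; change ((~` [set x | f x = j]) x); near: x.
Unshelve. all: by end_near. Qed.

(** Compactness of the segment gives a cluster point, and an ultrafilter converges to each of its
    cluster points. *)
Lemma ultra_cvg_bounded {R : realType} (T : Type) (U : set_system T)
    (f : T -> R) (a b : R) : UltraFilter U ->
  (\forall x \near U, a <= f x <= b) -> exists l : R, f x @[x --> U] --> l.
Proof.
move=> UU H.
have [] := @segment_compact R a b (fmap f U) _ _.
  by near=> x; rewrite /= in_itv /=; near: x.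
move=> l [_ cl]; exists l => V lV.
have [//|UV] := in_ultra_setVsetC (f @^-1` V) UU.
have [y [+ Vy]] := cl (~` V) V UV lV.
by [].
Unshelve. all: by end_near. Qed.

End UltraLimits.

(** * Signomials in logarithmic coordinates, as exponential sums *)

Section ExpSums.
Context {R : realType} {n : nat}.
Implicit Types (u w x : 'rV[R]_n) (a b : 'rV[int]_n) (s : seq 'rV[int]_n).

Lemma dotRDl u w x : dotR (u + w) x = dotR u x + dotR w x.
Proof. by rewrite /dotR -big_split; apply: eq_bigr => i _; rewrite mxE mulrDl. Qed.

Lemma dotRZl k u x : dotR (k *: u) x = k * dotR u x.
Proof. by rewrite /dotR mulr_sumr; apply: eq_bigr => i _; rewrite mxE mulrA. Qed.

Lemma dotRC u x : dotR u x = dotR x u.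
Proof. by apply: eq_bigr => i _; rewrite mulrC. Qed.

Lemma dotRBr u x y : dotR u (x - y) = dotR u x - dotR u y.
Proof.
by rewrite dotRC dotRDl -scaleN1r dotRZl mulN1r !(dotRC _ u).
Qed.

Lemma dotRBl u w x : dotR (u - w) x = dotR u x - dotR w x.
Proof. by rewrite dotRC dotRBr !(dotRC x). Qed.

Lemma dotR_sumr u (I : Type) (r : seq I) (l : I -> R) (p : I -> 'rV[R]_n) :
  dotR u (\sum_(i <- r) l i *: p i) = \sum_(i <- r) l i * dotR u (p i).
Proof.
rewrite /dotR; under [RHS]eq_bigr do rewrite mulr_sumr.
rewrite exchange_big; apply: eq_bigr => i _ /=.
rewrite summxE mulr_sumr; apply: eq_bigr => j _.
by rewrite mxE mulrCA.
Qed.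

Lemma dotR_eq0 u : (dotR u u == 0) = (u == 0).
Proof.
apply/eqP/eqP => [H|->]; last by rewrite /dotR big1 // => i _; rewrite mxE mul0r.
apply/rowP => i; rewrite mxE.
apply/eqP; rewrite -sqrf_eq0 expr2; apply/eqP.
by apply: (psumr_eq0P _ H) => // j _; rewrite -expr2 sqr_ge0.
Qed.

Lemma dotR_ge0 u : 0 <= dotR u u.
Proof. by apply: sumr_ge0 => i _; rewrite -expr2 sqr_ge0. Qed.

Definition expv u : 'rV[R]_n := map_mx (@expR R) u.

Lemma posvec_expv u : posvec (expv u).
Proof. by move=> i; rewrite mxE expR_gt0. Qed.

Lemma expv_onto x : posvec x -> exists u, x = expv u.
Proof.
move=> xp; exists (map_mx (@ln R) x); apply/rowP => i.
by rewrite !mxE lnK // posrE.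
Qed.

Lemma mono_expv u a : mono (expv u) a = expR (dotR u (vecR a)).
Proof.
rewrite /mono /dotR expR_sum; apply: eq_bigr => i _.
rewrite !mxE mulrC; case: (a 0 i) => k.
  by rewrite -exprnP expRM_natl.
by rewrite NegzE mulrNz mulNr expRN expRM_natl exprnN.
Qed.

Definition expsum (g : 'rV[int]_n -> R) s u : R :=
  \sum_(a <- s) g a * expR (dotR u (vecR a)).

(** The sign is read off the full [Am], so that one coefficient function serves the truncations to
    all faces. *)
Definition signed (Am : seq 'rV[int]_n) (c : 'rV[int]_n -> R) a : R :=
  if a \in Am then - c a else c a.

Lemma signomial_expv Bp Bm Am c u :
    (forall a, a \in Bp -> a \notin Am) -> {subset Bm <= Am} ->
  signomial Bp Bm c (expv u) = expsum (signed Am c) (Bp ++ Bm) u.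
Proof.
move=> dis sub; rewrite /expsum big_cat /signomial; congr (_ + _).
  by apply: eq_big_seq => a /dis /negbTE H; rewrite /signed H mono_expv.
rewrite -sumrN; apply: eq_big_seq => a /sub H.
by rewrite /signed H mono_expv mulNr.
Qed.

Lemma xdsignomial_expv Bp Bm Am c u i :
    (forall a, a \in Bp -> a \notin Am) -> {subset Bm <= Am} ->
  xdsignomial Bp Bm c (expv u) i =
  \sum_(a <- Bp ++ Bm) signed Am c a * (a 0 i)%:~R * expR (dotR u (vecR a)).
Proof.
move=> dis sub; rewrite big_cat /xdsignomial; congr (_ + _).
  by apply: eq_big_seq => a /dis /negbTE H; rewrite /signed H mono_expv.
rewrite -sumrN; apply: eq_big_seq => a /sub H.
by rewrite /signed H mono_expv !mulNr.
Qed.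

Lemma ler_expsum g g' s u : (forall a, a \in s -> g a <= g' a) ->
  expsum g s u <= expsum g' s u.
Proof.
move=> le; rewrite /expsum !big_seq; apply: ler_sum => a /le.
by rewrite ler_pM2r ?expR_gt0.
Qed.

Lemma is_derive_expsum (g : 'rV[int]_n -> R) s u w (t : R) :
  is_derive t (1 : R) (fun t : R => expsum g s (u + t *: w))
    (\sum_(a <- s) g a * dotR w (vecR a) * expR (dotR (u + t *: w) (vecR a))).
Proof.
rewrite /expsum; elim: s => [|b s IH].
  under eq_fun do rewrite big_nil; rewrite big_nil; exact: is_derive_cst.
under eq_fun do rewrite big_cons; rewrite big_cons.
apply: is_deriveD.
rewrite dotRDl dotRZl; under eq_fun do rewrite dotRDl dotRZl.
apply: is_derive_eq.
rewrite /GRing.scale /=; ring.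
Qed.

(** A zero of a nonnegative function is a global minimum, so the derivative along each coordinate
    direction vanishes there. *)
Lemma expsum_critical g s u : (forall w, 0 <= expsum g s w) -> expsum g s u = 0 ->
  forall i, \sum_(a <- s) g a * (a 0 i)%:~R * expR (dotR u (vecR a)) = 0.
Proof.
move=> H0 Hu i; pose w : 'rV[R]_n := delta_mx 0 i.
have d0 := @is_derive_expsum g s u w 0.
have d1 : is_derive (0:R) 1 (fun t => expsum g s (u + t *: w)) 0.
  apply: (@derive1_at_min _ _ (-1) 1).
  - by lra.
  - by move=> t _; have := @is_derive_expsum g s u w t; case.
  - by rewrite in_itv /=; apply/andP; split; lra.
  - by move=> t _; rewrite scale0r addr0 Hu.
have := @derive_val _ _ _ _ _ _ _ d0; rewrite (@derive_val _ _ _ _ _ _ _ d1).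
rewrite scale0r addr0 => d0E; rewrite [RHS]d0E.
apply: eq_bigr => a _; congr (_ * _ * _).
rewrite /dotR (bigD1 i) //= big1 ?addr0 => [|j /negbTE ji].
  by rewrite !mxE !eqxx mul1r.
by rewrite !mxE ji andbF mul0r.
Qed.

End ExpSums.

(** * Convex hulls of exponents, their faces and vertices *)

Section Faces.
Context {R : realType} {n : nat}.
Implicit Types (u w x y : 'rV[R]_n) (a b : 'rV[int]_n) (s : seq 'rV[int]_n).

Lemma seq_argmax (I : eqType) (f : I -> R) (s : seq I) : s != [::] ->
  exists2 i, i \in s & forall j, j \in s -> f j <= f i.
Proof.
elim: s => // i [|k s] IH _.
  by exists i; rewrite ?mem_head // => j; rewrite inE => /eqP ->.
have [//|j js jmax] := IH.
have [ij|ji] := leP (f i) (f j).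
  exists j => [|l]; first by rewrite in_cons js orbT.
  by move=> /predU1P[->//|]; exact: jmax.
exists i; rewrite ?mem_head // => l /predU1P[->//|/jmax]; move/le_trans; apply.
exact: ltW.
Qed.

Lemma ler_term_sum (I : eqType) (r : seq I) (f : I -> R) i :
  (forall j, j \in r -> 0 <= f j) -> i \in r -> f i <= \sum_(j <- r) f j.
Proof.
move=> f0 ir; rewrite (perm_big _ (perm_to_rem ir)) big_cons lerDl big_seq.
by apply: sumr_ge0 => j /mem_rem; exact: f0.
Qed.

Lemma conv_mem s a : uniq s -> a \in s -> conv s (vecR a : 'rV[R]_n).
Proof.
move=> us sa; exists (fun b => (b == a)%:R); split; first by move=> b; rewrite ler0n.
have off b : b != a -> (b == a)%:R = 0 :> R by move/negbTE ->.
split; rewrite (bigD1_seq a) //= eqxx big1 ?addr0 ?scale1r // => b /off -> //.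
by rewrite scale0r.
Qed.

(** The weighted gaps [l a * (m - dotR w (vecR a))] are nonnegative with sum at most 0, so each of
    them vanishes. *)
Lemma conv_argmax s (l : 'rV[int]_n -> R) w (m : R) : (forall a, 0 <= l a) ->
    \sum_(a <- s) l a = 1 -> (forall a, a \in s -> dotR w (vecR a) <= m) ->
    m <= dotR w (\sum_(a <- s) l a *: vecR a) ->
  forall a, a \in s -> l a = 0 \/ dotR w (vecR a) = m.
Proof.
move=> l0 l1 wm mw a sa.
(* The indicator of [s] makes the summand nonnegative for every [b], as [psumr_eq0] requires. *)
have /eqP : \sum_(b <- s) l b * (m - dotR w (vecR b)) * (b \in s)%:R = 0.
  apply/eqP; rewrite eq_le; apply/andP; split.
    move: mw; rewrite dotR_sumr -subr_le0; apply: le_trans.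
    have mE : m = \sum_(b <- s) l b * m by rewrite -mulr_suml l1 mul1r.
    rewrite [X in _ <= X - _]mE -sumrB le_eqVlt; apply/orP; left.
    by apply/eqP/eq_big_seq => b bs; rewrite bs mulr1 mulrBr.
  apply: sumr_ge0 => b _; case: (boolP (b \in s)) => [/wm wb|_]; last by rewrite /= mulr0.
  by rewrite /= mulr1 mulr_ge0 // subr_ge0.
rewrite psumr_eq0 => [/allP /(_ _ sa)|b _].
  by rewrite sa /= mulr1 mulf_eq0 subr_eq0 => /orP[/eqP|/eqP]; [left|right].
case: (boolP (b \in s)) => [/wm wb|_]; last by rewrite /= mulr0.
by rewrite /= mulr1 mulr_ge0 // subr_ge0.
Qed.

Lemma face_of_refl (P : 'rV[R]_n -> Prop) : face_of P P.
Proof.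
exists 0 => x; split=> [Px|[]//]; split=> // y _.
by rewrite -[0](scale0r x) !dotRZl !mul0r.
Qed.

(** This turns a face of a face into a test on exponents: the maximum of [w] over [F] is already
    reached at an exponent lying in [F]. *)
Lemma trunc_face s (F G : 'rV[R]_n -> Prop) w a0 : uniq s ->
    face_of (conv s) F ->
    (forall x, G x <-> F x /\ forall y, F y -> dotR w y <= dotR w x) ->
    a0 \in trunc F s ->
    (forall a, a \in trunc F s -> dotR w (vecR a) <= dotR w (vecR a0)) ->
  trunc G s = [seq a <- trunc F s | dotR w (vecR a) == dotR w (vecR a0)].
Proof.
move=> us [w0 Fw0] GF a0F a0max; rewrite /trunc -filter_predI.
have Fmax y : F y -> dotR w y <= dotR w (vecR a0).
  move=> Fy; have [[l [l0 [l1 yE]]] ymax] := (Fw0 y).1 Fy.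
  (* A point of [F] is a convex combination of exponents that lie in [F] themselves. *)
  have supp a : a \in s -> l a = 0 \/ F (vecR a).
    move=> sa.
    have [||la|E] := conv_argmax s l w0 (dotR w0 y) l0 l1 _ _ a sa.
    - by move=> b /(conv_mem s b us) /ymax.
    - by rewrite -yE.
    - by left.
    - by right; apply/Fw0; rewrite E; split; first exact: conv_mem.
  rewrite yE dotR_sumr -[leRHS]mul1r -[X in _ <= X * _]l1 mulr_suml !big_seq.
  apply: ler_sum => a sa.
  have [->|Fa] := supp a sa; first by rewrite !mul0r.
  by rewrite ler_wpM2l // a0max // mem_filter sa andbT; apply/asboolP.
move: a0F; rewrite mem_filter => /andP[/asboolP Fa0 _].
apply: eq_in_filter => a sa /=; apply/asboolP/andP.
  move=> /GF[Fa amax]; split; last exact/asboolP.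
  by rewrite eq_le amax // Fmax.
move=> [/eqP E /asboolP Fa]; apply/GF; split=> // y; rewrite E; exact: Fmax.
Qed.

(* The maximizer of [<w, a> + |a|^2] is exposed by [w + 2 v], because
   [|a - v|^2 >= 0] with equality only at [v]. *)
Lemma vertex_almost_max s w : uniq s -> s != [::] ->
  exists v, [/\ v \in s, vertex (conv s) (vecR v : 'rV[R]_n) &
    forall a, a \in s ->
      dotR w (vecR a) <= dotR w (vecR v) + dotR (vecR v) (vecR v : 'rV[R]_n)].
Proof.
move=> us s0.
have [v vs vmax] := seq_argmax _
  (fun a => dotR w (vecR a) + dotR (vecR a) (vecR a : 'rV[R]_n)) s s0.
exists v; split=> //; last first.
  by move=> a /vmax; apply: le_trans; rewrite lerDl dotR_ge0.
set vv : 'rV[R]_n := vecR v in vmax *.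
pose w' := w + 2 *: vv.
have gap a : a \in s ->
    dotR w' (vecR a) + dotR (vecR a - vv) (vecR a - vv) <= dotR w' vv.
  move=> /vmax; rewrite /w' dotRBl !dotRDl !dotRZl !dotRBr.
  rewrite [dotR (vecR a) vv]dotRC; lra.
have w'max a : a \in s -> dotR w' (vecR a) <= dotR w' vv.
  by move=> /gap; apply: le_trans; rewrite lerDl dotR_ge0.
exists w' => x; split=> [->|[[l [l0 [l1 xE]]] xmax]].
  split; first exact: conv_mem.
  move=> y [l [l0 [l1 ->]]].
  rewrite dotR_sumr -[leRHS]mul1r -[X in _ <= X * _]l1 mulr_suml !big_seq; apply: ler_sum => a sa.
  by rewrite ler_wpM2l // w'max.
have supp a : a \in s -> l a *: vecR a = l a *: vv.
  move=> sa.
  have [|->|E] := conv_argmax s l w' (dotR w' vv) l0 l1 w'max _ a sa.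
  - by rewrite -xE; apply/xmax/conv_mem.
  - by rewrite !scale0r.
  have := gap a sa; rewrite E gerDl => le0.
  have : dotR (vecR a - vv) (vecR a - vv) == 0 by rewrite eq_le le0 dotR_ge0.
  by rewrite dotR_eq0 subr_eq0 => /eqP ->.
by rewrite xE (eq_big_seq _ supp) -scaler_suml l1 scale1r.
Qed.

(** * Truncations as limits, and limits of sequences of points *)

Local Open Scope classical_set_scope.

(** At [u + k *: w], after division by [expR (k * m)], the terms on the face stay fixed and the
    others decay geometrically in [k]. *)
Lemma expsum_face_ge0 (g : 'rV[int]_n -> R) s w (m : R) :
    (forall u, 0 <= expsum g s u) ->
    (forall a, a \in s -> dotR w (vecR a) <= m) ->
  forall u, 0 <= expsum g [seq a <- s | dotR w (vecR a) == m] u.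
Proof.
move=> g0 wm u.
pose f a (k : nat) : R := g a * expR (dotR u (vecR a)) * expR (dotR w (vecR a) - m) ^+ k.
have cf : (\sum_(a <- s) f a k) @[k --> \oo] -->
    \sum_(a <- s) g a * expR (dotR u (vecR a)) * (dotR w (vecR a) == m)%:R.
  apply: cvg_sum_in => a /wm wa; apply: cvgM; first exact: cvg_cst.
  case: eqP => [->|/eqP ne].
    by apply: cvg_near_cst; near=> k; rewrite subrr expR0 expr1n.
  apply: cvg_expr; rewrite ger0_norm ?expR_ge0 // -expR0 ltr_expR subr_lt0.
  by rewrite lt_neqAle ne.
have -> : expsum g [seq a <- s | dotR w (vecR a) == m] u =
    \sum_(a <- s) g a * expR (dotR u (vecR a)) * (dotR w (vecR a) == m)%:R.
  rewrite /expsum big_filter big_mkcond; apply: eq_bigr => a _.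
  by case: eqP; rewrite ?mulr1 ?mulr0.
apply: (cvgr_to_ge cf); near=> k.
have : 0 <= expsum g s (u + k%:R *: w) * expR (- (k%:R * m)).
  by rewrite mulr_ge0 ?expR_ge0.
rewrite /expsum mulr_suml => /le_trans; apply; rewrite le_eqVlt; apply/orP; left.
apply/eqP/eq_bigr => a _; rewrite /f -expRM_natl -!mulrA -!expRD; congr (_ * expR _).
by rewrite dotRDl dotRZl; ring.
Unshelve. all: by end_near. Qed.

Lemma trunc_conv s : uniq s -> trunc (conv s : 'rV[R]_n -> Prop) s = s.
Proof. by move=> us; apply/all_filterP/allP => a sa; exact/asboolP/conv_mem. Qed.

Lemma expsum_trunc_ge0 (g : 'rV[int]_n -> R) s (F G : 'rV[R]_n -> Prop) :
    uniq s -> face_of (conv s) F -> face_of F G ->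
    (forall u, 0 <= expsum g (trunc F s) u) ->
  forall u, 0 <= expsum g (trunc G s) u.
Proof.
move=> us fF [w Gw] g0 u; have [F0|F0] := eqVneq (trunc F s) [::].
  suff -> : trunc G s = [::] by rewrite /expsum big_nil.
  apply/eqP; rewrite -F0 eq_sym; apply/eqP/eq_in_filter => a sa.
  have aF : a \notin trunc F s by rewrite F0.
  move: aF; rewrite mem_filter sa andbT => nF; rewrite (negbTE nF).
  by apply/esym/negbTE; apply: contra nF => /asboolP/Gw[Fa _]; exact/asboolP.
have [a0 a0F a0max] := seq_argmax _ (fun a => dotR w (vecR a)) _ F0.
by rewrite (trunc_face _ _ _ _ _ us fF Gw a0F a0max); exact: expsum_face_ge0.
Qed.

(* A weak form of the compactness of the nonnegative part of a projective
   toric variety. With [z k] the component of [u k] left after removing the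
   convergent part in the directions spanned by the differences of the
   exponents that stay comparable to the maximal one, the limit face is the one
   exposed by [z k] for a suitable large [k]. *)
Lemma toric_limit s (u : nat -> 'rV[R]_n) : s != [::] ->
  exists U : set_system nat, [/\ ProperFilter U, \oo `<=` U &
  exists w a0 (x : 'rV[R]_n), [/\ a0 \in s,
    (forall a, a \in s -> dotR w (vecR a) <= dotR w (vecR a0)) &
    forall a, a \in s ->
      expR (dotR (u k) (vecR a) - dotR (u k) (vecR a0)) @[k --> U] -->
      (if dotR w (vecR a) == dotR w (vecR a0)
       then expR (dotR x (vecR a) - dotR x (vecR a0)) else 0 : R)]].
Proof.
move=> s0; have [U [UU ooU]] := ultraFilterLemma (F := (\oo : set_system nat)) _.
exists U; split; [exact: ultra_proper|exact: ooU|].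
have /choice[f /all_and2[fs fmax]] : forall k, exists i, i \in s /\
    forall j, j \in s -> dotR (u k) (vecR j) <= dotR (u k) (vecR i).
  by move=> k; have [i] := seq_argmax _ (fun a => dotR (u k) (vecR a)) s s0; exists i.
(* A single exponent [a0] is maximal at [u k] for [U]-almost all [k]. *)
have [a0 a0s Ua0] := ultra_pigeonhole _ U _ s f UU fs.
have max0 : \forall k \near U, forall a, a \in s ->
    dotR (u k) (vecR a) <= dotR (u k) (vecR a0).
  by apply: filterS Ua0 => k /= <-; exact: fmax.
(* [S] collects the exponents whose gap to [a0] stays bounded along [U]; the columns of [B] are
   their differences with [a0]. *)
pose d a k : R := dotR (u k) (vecR a0) - dotR (u k) (vecR a).
pose bd a := exists M, \forall k \near U, d a k <= M.
pose S := [seq a <- s | `[< bd a >]].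
pose N := size S.
pose e (j : 'I_N) : 'rV[int]_n := nth 0 S j.
pose B : 'M[R]_(n, N) := \matrix_(i, j) (vecR (e j) 0 i - vecR a0 0 i).
pose Q := pinvmx B.
have mulB x j : (x *m B) 0 j = dotR x (vecR (e j)) - dotR x (vecR a0).
  rewrite -dotRBr /dotR mxE; apply: eq_bigr => i _; by rewrite !mxE.
have /choice[l cl] : forall j : 'I_N, exists l : R, (u k *m B) 0 j @[k --> U] --> l.
  move=> j; have : e j \in S by rewrite mem_nth.
  rewrite mem_filter => /andP[/asboolP[M HM] es].
  apply: (@ultra_cvg_bounded _ _ _ _ (- M) 0); near=> k.
  rewrite mulB; apply/andP; split; last by rewrite subr_le0; move: (e j) es; near: k.
  rewrite lerNl opprB; near: k; exact: HM.
pose lr : 'rV[R]_N := \row_j l j.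
pose x := lr *m Q.
have cv i : (u k *m B *m Q) 0 i @[k --> U] --> x 0 i.
  rewrite /x mxE; under eq_fun do rewrite mxE.
  apply: cvg_sum_in => j _; apply: cvgM; last exact: cvg_cst.
  by rewrite mxE; exact: cl.
have cdot (y : 'rV[R]_n) : dotR (u k *m B *m Q) y @[k --> U] --> dotR x y.
  by apply: cvg_sum_in => i _; apply: cvgM; [exact: cv|exact: cvg_cst].
(* The limits [l] are attained exactly by [x]: multiplying by [Q] and then by [B] fixes [u k *m B],
   and this identity passes to the limit. *)
have xB : x *m B = lr.
  apply/rowP => j; rewrite [RHS]mxE.
  have cj : (u k *m B) 0 j @[k --> U] --> (x *m B) 0 j.
    have -> : (fun k => (u k *m B) 0 j) =
        (fun k => dotR (u k *m B *m Q) (vecR (e j) - vecR a0)).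
      by apply/funext => k; rewrite dotRBr -mulB mulmxKpV // submxMl.
    by rewrite mulB -dotRBr; exact: cdot.
  by apply: (cvg_unique _ cj (cl j)); exact: norm_hausdorff.
have memS a : a \in S -> exists j : 'I_N, e j = a.
  by move=> aS; exists (Ordinal (etrans (index_mem a S) aS)); rewrite /e /= nth_index.
pose z k := u k - u k *m B *m Q.
have zS k a : a \in S -> dotR (z k) (vecR a) = dotR (z k) (vecR a0).
  move=> /memS[j <-]; apply/eqP; rewrite -subr_eq0 -mulB /z mulmxBl.
  by rewrite (mulmxKpV (submxMl _ _)) subrr mxE.
(* For an ultrafilter, a gap that is not eventually bounded exceeds every constant eventually. *)
have unbd a M : a \in s -> a \notin S -> \forall k \near U, M < d a k.
  rewrite mem_filter => -> /=; rewrite andbT => /asboolP nb.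
  have [H|H] := in_ultra_setVsetC [set k | d a k <= M] UU.
    by exfalso; apply: nb; exists M.
  by apply: filterS H => k /= /negP; rewrite -ltNge.
(* [z k] differs from [u k] by a convergent vector, so the unbounded gaps outside [S] eventually
   become strictly positive for [z k]. *)
have [k zk] : exists k, forall a, a \in s -> a \notin S ->
    dotR (z k) (vecR a) < dotR (z k) (vecR a0).
  suff /filter_ex H : \forall k \near U, forall a, a \in s -> a \notin S ->
    dotR (z k) (vecR a) < dotR (z k) (vecR a0) by exact: H.
  apply: filter_all_in => a sa.
  case: (boolP (a \in S)) => [_|aS]; first by near=> k.
  pose y : 'rV[R]_n := vecR a0 - vecR a.
  have H1 : \forall k \near U, dotR (u k *m B *m Q) y <= dotR x y + 1.
    by apply: (cvgr_le _ (cdot y)); rewrite ltrDl.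
  have H2 := unbd a (dotR x y + 1) sa aS.
  near=> k => _.
  have h1 : dotR (u k *m B *m Q) y <= dotR x y + 1 by near: k.
  have h2 : dotR x y + 1 < d a k by near: k.
  rewrite -subr_gt0 -dotRBr /z dotRBl subr_gt0.
  move: h1 h2; rewrite /d -dotRBr -/y.
  exact: le_lt_trans.
exists (z k), a0, x; split=> // a sa.
  by case: (boolP (a \in S)) => [/zS ->//|/(zk _ sa)/ltW].
have -> : (dotR (z k) (vecR a) == dotR (z k) (vecR a0)) = (a \in S).
  by case: (boolP (a \in S)) => [/zS ->|/(zk _ sa)/lt_eqF ->]; rewrite ?eqxx.
case: (boolP (a \in S)) => [/memS[j <-]|aS].
  apply: continuous_cvg; first exact: continuous_expR.
  under eq_fun do rewrite -mulB; rewrite -mulB xB mxE; exact: cl.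
apply/cvgrPdist_lt => eps eps0.
near=> j.
rewrite sub0r normrN ger0_norm ?expR_ge0 // -[eps]lnK ?posrE // ltr_expR.
rewrite -opprB ltrNl; near: j; exact: unbd.
Unshelve. all: by end_near. Qed.

End Faces.

(** * Copositivity along the path with coefficients [c a * t ^ h a] *)

Section Path.
Context {R : realType} {n : nat}.
Implicit Types (u w x : 'rV[R]_n) (a b : 'rV[int]_n) (Ap Am s : seq 'rV[int]_n).
Implicit Types (c : 'rV[int]_n -> R) (h : 'rV[int]_n -> int) (t : R).

Definition coef Am c h t : 'rV[int]_n -> R := signed Am (fun a => c a * t ^ h a).

Lemma coef1 Am c h : coef Am c h 1 = signed Am c.
Proof. by apply/funext => a; rewrite /coef /signed exp1rz mulr1. Qed.

Lemma coef_Ap Ap Am c h t a : (forall a, a \in Ap -> a \notin Am) ->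
  lifts Ap Am h -> a \in Ap -> coef Am c h t a = c a.
Proof.
by move=> dis [_ h0] aA; rewrite /coef /signed (negbTE (dis a aA)) h0 // expr0z mulr1.
Qed.

Lemma coef_Am Am c h t b : b \in Am -> coef Am c h t b = - (c b * t ^ h b).
Proof. by rewrite /coef /signed => ->. Qed.

Lemma coef_anti Ap Am c h t t' a : (forall a, a \in Ap -> a \notin Am) ->
    lifts Ap Am h -> (forall a, a \in Ap ++ Am -> 0 < c a) ->
    0 < t -> t <= t' -> a \in Ap ++ Am ->
  coef Am c h t' a <= coef Am c h t a.
Proof.
move=> dis hl c0 t0 tt' aA; have ca := c0 a aA.
move: aA; rewrite mem_cat => /orP[aA|aA].
  by rewrite !(coef_Ap Ap).
rewrite !coef_Am // lerN2 ler_pM2l //; case: hl => h0 _.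
apply: ler_wpXz2r => //; first exact/ltW/h0.
  by rewrite nnegrE ltW.
by rewrite nnegrE ltW // (lt_le_trans t0).
Qed.

Lemma coef_ltr Ap Am c h t t' b :
    lifts Ap Am h -> (forall a, a \in Ap ++ Am -> 0 < c a) ->
    0 < t -> t < t' -> b \in Am ->
  coef Am c h t' b < coef Am c h t b.
Proof.
move=> [hl _] c0 t0 tt' bA; rewrite !coef_Am // ltrN2 ltr_pM2l ?c0 ?mem_cat ?bA ?orbT //.
rewrite ltr_pXz2r ?hl // nnegrE ltW //; exact: lt_trans tt'.
Qed.

Lemma cvg_coef Ap Am c h (T : Type) (F : set_system T) (f : T -> R) t a :
    Filter F -> lifts Ap Am h -> a \in Ap ++ Am ->
  (f x @[x --> F] --> t)%classic -> (coef Am c h (f x) a @[x --> F] --> coef Am c h t a)%classic.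
Proof.
move=> FF [h1 h0] aA ft.
(* Heights are nonnegative on the support, so the integer power is a natural one, continuous at
   every [t]. *)
have [m hm] : exists m : nat, h a = m.
  move: aA; rewrite mem_cat => /orP[/h0 ->|/h1]; first by exists 0%N.
  by case: (h a) => // m _; exists m.
have cX : (f x ^+ m @[x --> F] --> t ^+ m)%classic.
  exact: (cvg_comp f (fun y : R => y ^+ m) ft (@exprn_continuous R m t)).
rewrite /coef /signed hm; case: ifP => _.
  by apply: cvgN; apply: cvgM => //; exact: cvg_cst.
by apply: cvgM => //; exact: cvg_cst.
Qed.

Lemma uniq_support Ap Am : uniq Ap -> uniq Am ->
  (forall a, a \in Ap -> a \notin Am) -> uniq (Ap ++ Am).
Proof.
move=> up um dis; rewrite cat_uniq up um andbT /=; apply/hasPn => a aA.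
by apply/negP => /dis; rewrite aA.
Qed.

(** Truncation to a face preserves nonnegativity; conversely, as [Gam] contains [Am], the discarded
    terms all have positive coefficients. *)
Lemma copositiveP Ap Am c h (Gam : 'rV[R]_n -> Prop) : uniq Ap -> uniq Am ->
    (forall a, a \in Ap -> a \notin Am) ->
    face_of (conv (Ap ++ Am)) Gam -> (forall b, b \in Am -> Gam (vecR b)) ->
    (forall a, a \in Ap ++ Am -> 0 < c a) ->
  copositive Ap Am c <->
  forall u, 0 <= expsum (coef Am c h 1) (trunc Gam (Ap ++ Am)) u.
Proof.
move=> up um dis fG GAm c0.
have us := uniq_support _ _ up um dis.
rewrite coef1; split=> H.
  apply: (expsum_trunc_ge0 _ _ (conv (Ap ++ Am))) => //; first exact: face_of_refl.
  move=> u; rewrite trunc_conv // -signomial_expv //; apply: H; exact: posvec_expv.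
move=> _ /expv_onto[u ->]; rewrite (signomial_expv _ _ Am) // /expsum.
rewrite (bigID (fun a => `[< Gam (vecR a) >])) /= -big_filter.
apply: addr_ge0; first exact: H.
rewrite big_seq_cond; apply: sumr_ge0 => a /andP[aA nG].
apply: mulr_ge0; last exact: expR_ge0.
rewrite /signed; case: ifPn => [/GAm Ga|_]; last exact/ltW/c0.
by case/negP: nG; apply/asboolP.
Qed.

Lemma exists_copositive Ap Am c h : uniq Ap -> uniq Am -> Am != [::] ->
    (forall a, a \in Ap -> a \notin Am) ->
    (forall v : 'rV[R]_n, vertex (conv (Ap ++ Am)) v ->
       exists2 a, a \in Ap & v = vecR a) ->
    (forall a, a \in Ap ++ Am -> 0 < c a) -> lifts Ap Am h ->
  exists2 t, 0 < t & forall u, 0 <= expsum (coef Am c h t) (Ap ++ Am) u.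
Proof.
move=> up um m0 dis vx c0 hl.
have us := uniq_support _ _ up um dis.
have s0 : Ap ++ Am != [::].
  by case: (Am) m0 => // b r _; case: (Ap).
have cp a : a \in Ap -> 0 < c a by move=> aA; rewrite c0 ?mem_cat ?aA.
have cm a : a \in Am -> 0 < c a by move=> aA; rewrite c0 ?mem_cat ?aA ?orbT.
have [d _ dmax] := seq_argmax _ (fun a => dotR (vecR a) (vecR a : 'rV[R]_n)) _ s0.
(* [K] is the loss in comparing a monomial with one at a vertex, [L] bounds monomials of [Ap] by the
   positive part [P], and [C] is the total negative coefficient. *)
pose K := expR (dotR (vecR d) (vecR d : 'rV[R]_n)).
pose L := \sum_(a <- Ap) (c a)^-1.
pose C := \sum_(b <- Am) c b.
have L0 : 0 <= L.
  by rewrite /L big_seq; apply: sumr_ge0 => a /cp/ltW; rewrite invr_ge0.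
have C0 : 0 <= C by rewrite /C big_seq; apply: sumr_ge0 => a /cm/ltW.
have K0 : 0 <= K by exact: expR_ge0.
have D0 : 0 < 1 + C * K * L by rewrite ltr_wpDr // !mulr_ge0.
(* With this [t], [t * (C * K * L)] is at most 1; the added 1 also gives [t <= 1], hence
   [t ^ h b <= t] because [h b] is at least 1. *)
pose t := (1 + C * K * L)^-1.
have t0 : 0 < t by rewrite invr_gt0.
have t1 : t <= 1 by rewrite invf_le1 // lerDl !mulr_ge0.
exists t => // u; rewrite /expsum big_cat /=.
pose P := \sum_(a <- Ap) c a * expR (dotR u (vecR a)).
have P0 : 0 <= P.
  by rewrite /P big_seq; apply: sumr_ge0 => a /cp/ltW ca; rewrite mulr_ge0 ?expR_ge0.
have le_P a : a \in Ap -> expR (dotR u (vecR a)) <= L * P.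
  move=> aA; have ca := cp a aA.
  apply: (@le_trans _ _ ((c a)^-1 * (c a * expR (dotR u (vecR a))))).
    by rewrite mulKf ?gt_eqF.
  apply: ler_pM; [by rewrite invr_ge0 ltW|by rewrite mulr_ge0 ?expR_ge0 ?ltW| |].
    apply: (ler_term_sum _ _ (fun a => (c a)^-1)) => // j /cp/ltW.
    by rewrite invr_ge0.
  apply: (ler_term_sum _ _ (fun a => c a * expR (dotR u (vecR a)))) => // j /cp/ltW cj.
  by rewrite mulr_ge0 ?expR_ge0.
have le_KLP b : b \in Am -> expR (dotR u (vecR b)) <= K * (L * P).
  move=> bA; have [v [vA /vx[a aA va] vmax]] := vertex_almost_max _ u us s0.
  apply: (@le_trans _ _ (expR (dotR (vecR v) (vecR v : 'rV[R]_n)) * expR (dotR u (vecR v)))).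
    by rewrite -expRD ler_expR addrC vmax // mem_cat bA orbT.
  apply: ler_pM; rewrite ?expR_ge0 ?ler_expR ?dmax //.
  by rewrite va le_P.
have -> : \sum_(a <- Ap) coef Am c h t a * expR (dotR u (vecR a)) = P.
  by apply: eq_big_seq => a aA; rewrite (coef_Ap Ap).
suff H : \sum_(b <- Am) - (coef Am c h t b * expR (dotR u (vecR b))) <= P.
  by move: H; rewrite sumrN => H; rewrite -lerBlDr sub0r.
apply: (@le_trans _ _ (\sum_(b <- Am) c b * (t * (K * (L * P))))).
  rewrite !big_seq; apply: ler_sum => b bA.
  rewrite coef_Am // mulNr opprK -mulrA ler_pM2l ?cm //.
  apply: ler_pM; rewrite ?expR_ge0 ?le_KLP //; first exact/exprz_ge0/ltW.
  have := hl.1 b bA; case: (h b) => // -[//|m] _.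
  rewrite -exprnP exprS; apply: ler_piMr; first exact: ltW.
  by apply: exprn_ile1 => //; exact: ltW.
rewrite -mulr_suml -/C.
have -> : C * (t * (K * (L * P))) = t * (C * K * L) * P by ring.
apply: ler_piMl => //; rewrite /t mulrC ler_pdivrMr // mul1r.
by rewrite lerDr.
Qed.

(** At [u = 0] all monomials equal 1, so the negative term at [b] alone, [c b * t ^ h b], is at most
    the sum [C] of the other coefficients. *)
Lemma copositive_bounded Ap Am c h (F : 'rV[R]_n -> Prop) :
    uniq Ap -> uniq Am -> (forall a, a \in Ap -> a \notin Am) ->
    (exists2 b, b \in Am & F (vecR b)) ->
    (forall a, a \in Ap ++ Am -> 0 < c a) -> lifts Ap Am h ->
  exists M, forall t, 0 < t ->
    (forall u, 0 <= expsum (coef Am c h t) (trunc F (Ap ++ Am)) u) -> t <= M.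
Proof.
move=> up um dis [b bA Fb] c0 hl.
have us := uniq_support _ _ up um dis.
have bs : b \in Ap ++ Am by rewrite mem_cat bA orbT.
have bF : b \in trunc F (Ap ++ Am).
  by rewrite mem_filter bs andbT; apply/asboolP.
pose C := \sum_(a <- trunc F (Ap ++ Am) | a != b) c a.
(* The bound 1 covers small [t]; beyond it [t <= t ^ h b]. *)
exists (Num.max 1 (C / c b)) => t t0 /(_ 0).
have [t1 _|t1] := leP t 1; first by rewrite le_max t1.
have e0 a : expR (dotR (0 : 'rV[R]_n) (vecR a)) = 1.
  by rewrite -[0](scale0r (0 : 'rV[R]_n)) dotRZl mul0r expR0.
rewrite /expsum; under eq_bigr do rewrite e0 mulr1.
rewrite (bigD1_seq b) ?filter_uniq //= coef_Am // addrC subr_ge0 => H.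
rewrite le_max; apply/orP; right; rewrite ler_pdivlMr ?c0 // mulrC.
apply: (@le_trans _ _ (c b * t ^ h b)).
  rewrite ler_pM2l ?c0 //; have := hl.1 b bA; case: (h b) => // -[//|m] _.
  rewrite -exprnP exprS; apply: ler_peMr; first exact: ltW.
  by apply: exprn_ege1; exact: ltW.
apply: (le_trans H); rewrite /C big_seq_cond [leRHS]big_seq_cond.
apply: ler_sum => a /andP[]; rewrite mem_filter => /andP[_ aA] _.
have ca := c0 a aA; move: aA; rewrite mem_cat => /orP[aA|aA].
  by rewrite (coef_Ap Ap).
rewrite coef_Am //; apply: (@le_trans _ _ 0); last exact: ltW.
by rewrite oppr_le0 mulr_ge0 ?exprz_ge0 ?ltW.
Qed.

Lemma crit_zeroP Ap Am c h t (G : 'rV[R]_n -> Prop) u :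
    (forall a, a \in Ap -> a \notin Am) ->
  crit_zero (trunc G Ap) (trunc G Am) (fun a => c a * t ^ h a) (expv u) <->
  expsum (coef Am c h t) (trunc G (Ap ++ Am)) u = 0 /\
  forall i, \sum_(a <- trunc G (Ap ++ Am))
     coef Am c h t a * (a 0 i)%:~R * expR (dotR u (vecR a)) = 0.
Proof.
move=> dis; rewrite /crit_zero /trunc filter_cat.
have dis' a : a \in trunc G Ap -> a \notin Am.
  by rewrite mem_filter => /andP[_]; exact: dis.
have sub : {subset trunc G Am <= Am} by move=> a; rewrite mem_filter => /andP[].
rewrite (signomial_expv _ _ Am) //; split=> -[e0 ei]; split=> // i.
  by rewrite -(xdsignomial_expv _ _ Am) ?ei.
by rewrite (xdsignomial_expv _ _ Am) ?ei.
Qed.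

Lemma noncopositive_limit Ap Am c h (F : 'rV[R]_n -> Prop) (f : nat -> R) t :
    uniq Ap -> uniq Am -> (forall a, a \in Ap -> a \notin Am) ->
    (forall a, a \in Ap ++ Am -> 0 < c a) -> lifts Ap Am h ->
    face_of (conv (Ap ++ Am)) F ->
    trunc F (Ap ++ Am) != [::] ->
    (f k @[k --> \oo] --> t)%classic ->
    (forall k, exists u, expsum (coef Am c h (f k)) (trunc F (Ap ++ Am)) u < 0) ->
    (forall u, 0 <= expsum (coef Am c h t) (trunc F (Ap ++ Am)) u) ->
  exists G : 'rV[R]_n -> Prop, face_of F G /\
    (exists2 b, b \in Am & G (vecR b)) /\
    exists x, posvec x /\
      crit_zero (trunc G Ap) (trunc G Am) (fun a => c a * t ^ h a) x.
Proof.
move=> up um dis c0 hl fF F0 ft /choice[u u0] g0.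
have us := uniq_support _ _ up um dis.
have [U [UF ooU [w [a0 [x [a0F a0max cvU]]]]]] := toric_limit _ u F0.
pose G y := F y /\ forall z, F z -> dotR w z <= dotR w y.
have fG : face_of F G by exists w.
have GE := trunc_face _ F G w a0 us fF (fun _ => iff_refl _) a0F a0max.
have Gge0 := expsum_trunc_ge0 _ _ _ _ us fF fG g0.
have mem a : a \in trunc F (Ap ++ Am) -> a \in Ap ++ Am.
  by rewrite mem_filter => /andP[].
(* Dividing by the monomial at [a0] keeps the values negative and makes them converge; by [limE] the
   limit is the truncation to [G] at [x], up to a positive factor. *)
have cvS : ((\sum_(a <- trunc F (Ap ++ Am)) coef Am c h (f k) a *
     expR (dotR (u k) (vecR a) - dotR (u k) (vecR a0))) @[k --> U] -->
   \sum_(a <- trunc F (Ap ++ Am)) coef Am c h t a *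
     (if dotR w (vecR a) == dotR w (vecR a0)
      then expR (dotR x (vecR a) - dotR x (vecR a0)) else 0))%classic.
  apply: cvg_sum_in => a aF; apply: cvgM; last exact: cvU.
  by apply: (cvg_coef Ap) => //; [exact: mem|exact: cvg_trans (cvg_app f ooU) ft].
have limE : \sum_(a <- trunc F (Ap ++ Am)) coef Am c h t a *
     (if dotR w (vecR a) == dotR w (vecR a0)
      then expR (dotR x (vecR a) - dotR x (vecR a0)) else 0) =
    expsum (coef Am c h t) (trunc G (Ap ++ Am)) x * expR (- dotR x (vecR a0)).
  rewrite GE /expsum mulr_suml [RHS]big_filter [RHS]big_mkcond; apply: eq_bigr => a _.
  by case: ifP; rewrite ?mulr0 // expRD mulrA.
have le0 : expsum (coef Am c h t) (trunc G (Ap ++ Am)) x <= 0.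
  rewrite -(pmulr_lle0 _ (expR_gt0 (- dotR x (vecR a0)))) -limE.
  apply: (cvgr_to_le cvS); near=> k.
  rewrite (_ : \sum_(a <- _) _ = expsum (coef Am c h (f k)) (trunc F (Ap ++ Am)) (u k) *
      expR (- dotR (u k) (vecR a0))).
    by rewrite pmulr_lle0 ?expR_gt0 // ltW.
  by rewrite /expsum mulr_suml; apply: eq_bigr => a _; rewrite expRD mulrA.
have e0 : expsum (coef Am c h t) (trunc G (Ap ++ Am)) x = 0.
  by apply/eqP; rewrite eq_le le0 Gge0.
exists G; split => //; split; last first.
  exists (expv x); split; first exact: posvec_expv.
  by apply/crit_zeroP => //; split => //; exact: expsum_critical.
(* If [G] missed [Am], every term of the truncation would be positive, and the term at [a0] would
   contradict the value 0. *)
apply: contrapT => noAm.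
have a0G : a0 \in trunc G (Ap ++ Am) by rewrite GE mem_filter eqxx.
have GAp a : a \in trunc G (Ap ++ Am) -> a \in Ap.
  rewrite mem_filter mem_cat => /andP[/asboolP Ga /orP[//|aA]].
  by case: noAm; exists a.
have pos a : a \in trunc G (Ap ++ Am) ->
    0 < coef Am c h t a * expR (dotR x (vecR a)).
  by move=> /GAp aA; rewrite (coef_Ap Ap) // mulr_gt0 ?expR_gt0 ?c0 ?mem_cat ?aA.
have := ler_term_sum _ _ (fun a => coef Am c h t a * expR (dotR x (vecR a))) a0
  (fun a aG => ltW (pos a aG)) a0G.
by rewrite -/(expsum _ _ _) e0 leNgt pos.
Unshelve. all: by end_near. Qed.

End Path.

(** * The threshold as a supremum of copositive parameters *)

Theorem theorem2p7 (R : realType) (n : nat) (Ap Am : seq 'rV[int]_n)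
    (c : 'rV[int]_n -> R) (h : 'rV[int]_n -> int) (Gam : 'rV[R]_n -> Prop) :
  uniq Ap -> uniq Am ->
  (forall a, a \in Ap -> a \notin Am) ->
  Am != [::] ->
  (forall v : 'rV[R]_n, vertex (conv (Ap ++ Am)) v -> exists2 a, a \in Ap & v = vecR a) ->
  face_of (conv (Ap ++ Am)) Gam ->
  (forall b, b \in Am -> Gam (vecR b)) ->
  (forall G, face_of (conv (Ap ++ Am)) G ->
     (forall b, b \in Am -> G (vecR b)) -> forall x, Gam x -> G x) ->
  (forall a, a \in Ap ++ Am -> 0 < c a) ->
  lifts Ap Am h ->
  let S := fun t : R => 0 < t /\
      exists G : 'rV[R]_n -> Prop, face_of Gam G /\
        (exists2 b, b \in Am & G (vecR b)) /\
        exists x, posvec x /\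
          crit_zero (trunc G Ap) (trunc G Am) (fun a => c a * t ^ h a) x in
  exists tstar : R, S tstar /\ (forall t, S t -> tstar <= t) /\
    (copositive Ap Am c <-> 1 <= tstar).
Proof.
move=> up um dis m0 vx fG GAm _ c0 hl S.
set s := Ap ++ Am in vx fG c0.
have us : uniq s := uniq_support _ _ up um dis.
have [b0 b0A] : exists b, b \in Am.
  by case: (Am) m0 => // b r _; exists b; rewrite mem_head.
have F0 : trunc Gam s != [::].
  have : b0 \in trunc Gam s.
    by rewrite mem_filter mem_cat b0A orbT andbT; apply/asboolP/GAm.
  by case: (trunc Gam s).
pose cop t := forall u, 0 <= expsum (coef Am c h t) (trunc Gam s) u.
have cop_down t t' : 0 < t -> t <= t' -> cop t' -> cop t.
  move=> t0 tt' ct u; apply: le_trans (ct u) _; apply: ler_expsum => a.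
  rewrite mem_filter => /andP[_ aA].
  exact: (coef_anti Ap).
pose T : set R := [set t | 0 < t /\ cop t]%classic.
have [t0 t0p ct0] := exists_copositive _ _ c h up um m0 dis vx c0 hl.
have T0 : T t0.
  split=> //; apply: (expsum_trunc_ge0 _ _ (conv s)) => //; first exact: face_of_refl.
  by rewrite trunc_conv.
have [M TM] := copositive_bounded _ _ c h Gam up um dis
  (ex_intro2 _ _ b0 b0A (GAm b0 b0A)) c0 hl.
have hsT : has_sup T.
  by split; [exists t0|exists M => t [tp ct]; exact: TM].
pose ts := sup T.
have ts_ub t : 0 < t -> cop t -> t <= ts by move=> tp ct; apply: ub_le_sup => //; case: hsT.
have ts0 : 0 < ts by apply: lt_le_trans t0p _; apply: ts_ub => //; case: T0.
have cts : cop ts.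
  move=> u.
  (* Approach [ts] from below; the shift to [k.+1] keeps the parameters positive, since
     [harmonic 0 = 1]. *)
  have cvf : (ts * (1 - harmonic k.+1) @[k --> \oo] --> ts)%classic.
    suff : (ts * (1 - harmonic k.+1) @[k --> \oo] --> ts * (1 - 0))%classic.
      by rewrite subr0 mulr1.
    apply: cvgM; first exact: cvg_cst.
    apply: cvgB; first exact: cvg_cst.
    by rewrite (cvg_shiftS (@harmonic R)); exact: cvg_harmonic.
  have cvE : (expsum (coef Am c h (ts * (1 - harmonic k.+1))) (trunc Gam s) u
       @[k --> \oo] --> expsum (coef Am c h ts) (trunc Gam s) u)%classic.
    apply: cvg_sum_in => a; rewrite mem_filter => /andP[_ aA].
    apply: cvgM; last exact: cvg_cst.
    exact: (cvg_coef Ap).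
  apply: (cvgr_to_ge cvE); near=> k.
  have h1 : harmonic k.+1 < 1 :> R.
    by rewrite /harmonic invf_lt1 // ltr1n.
  have h0 : 0 < harmonic k.+1 :> R by exact: harmonic_gt0.
  have : ts * (1 - harmonic k.+1) < ts by rewrite gtr_pMr // gtrBl.
  move=> /sup_gt[]; first by exists t0.
  move=> t' [t'p ct'] /ltW lt'; apply: (cop_down _ _ _ lt' ct').
  by rewrite mulr_gt0 // subr_gt0.
exists ts; split; [|split].
(* Each [ts + harmonic k] lies above the supremum, so the truncation to [Gam] takes a negative value
   there. *)
- split=> //; apply: (noncopositive_limit _ _ c h Gam (fun k => ts + harmonic k)) => //.
    suff : (ts + harmonic k @[k --> \oo] --> ts + 0)%classic by rewrite addr0.
    by apply: cvgD; [exact: cvg_cst|exact: cvg_harmonic].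
  move=> k; apply: contrapT => no.
  have h0 : 0 < harmonic k :> R by exact: harmonic_gt0.
  have : ts + harmonic k <= ts.
    apply: ts_ub; first exact: addr_gt0.
    by move=> u; rewrite leNgt; apply/negP => H; apply: no; exists u.
  by rewrite gerDl leNgt h0.
(* If [t < ts], raising the parameter to [ts] strictly lowers the term at [b] and raises no other,
   so the zero at [t] would become a negative value at [ts]. *)
- move=> t [tp [G [fGG [[b bA Gb] [x [/expv_onto[u ->]]]]]]].
  move=> /(crit_zeroP _ _ _ _ _ _ _ dis)[e0 _]; rewrite leNgt; apply/negP => tts.
  have := expsum_trunc_ge0 _ _ _ _ us fG fGG cts u; rewrite leNgt => /negP; apply.
  rewrite -e0 /expsum.
  have bG : b \in trunc G s.
    by rewrite mem_filter mem_cat bA orbT andbT; apply/asboolP.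
  rewrite (bigD1_seq b) ?filter_uniq //= [ltRHS](bigD1_seq b) ?filter_uniq //=.
  apply: ltr_leD.
    by rewrite ltr_pM2r ?expR_gt0 //; exact: (coef_ltr Ap).
  rewrite big_seq_cond [leRHS]big_seq_cond; apply: ler_sum => a /andP[].
  rewrite mem_filter => /andP[_ aA] _; rewrite ler_pM2r ?expR_gt0 //.
  by apply: (coef_anti Ap) => //; exact: ltW.
(* Copositivity of the signomial is [cop 1], and the parameters satisfying [cop] form an interval
   ending at [ts]. *)
- have := copositiveP _ _ c h Gam up um dis fG GAm c0; rewrite -/(cop 1) => ->.
  by split=> [c1|ts1]; [exact: ts_ub|exact: cop_down cts].
Unshelve. all: by end_near. Qed.
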